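(* Let $K$ be a number field and let $E_1, E_2$ be elliptic curves over $K$ with $j$-invariant zero, given by $E_i: y^2=x^3+b_i$ with $b_i\in K^\times$. Then there exists $\lambda\in K^\times$ such that, letting $E_i'$ denote the sextic twist of $E_i$ by $\lambda$ (i.e. $E_i': y^2=x^3+\lambda b_i$), there are infinitely many $D\in K^\times$, with pairwise distinct images in $K^\times/(K^\times)^2$, such that the quadratic twists by $D$ of both $E_1'$ and $E_2'$ have positive Mordell–Weil rank over $K$.
   Context: The quadratic twist by $D\in K^\times$ of an elliptic curve $y^2=f(x)$ ($f$ a separable cubic) is the curve $Dy^2=f(x)$. Every elliptic curve over $K$ with $j$-invariant zero has a model $y^2=x^3+b$ with $b\in K^\times$. *)

(* Defs.v *)
From mathcomp Require Import all_boot all_order all_algebra all_field.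
From mathcomp Require Import boolp classical_sets cardinality.
From mathcomp Require Import reals constructive_ereal ereal Rstruct.

Set Implicit Arguments.
Unset Strict Implicit.
Unset Printing Implicit Defensive.

Import Order.TTheory GRing.Theory Num.Theory.

Local Open Scope classical_set_scope.
Local Open Scope ring_scope.

(* [Curve D f] is the projective curve with affine equation D * y^2 = f(x).
   It is an elliptic curve, with origin its unique point at infinity, when the
   characteristic is not 2, D != 0 and f is a separable cubic; the group law
   below is only meaningful under these conditions. *)
Record curve (K : fieldType) := Curve { ycoef : K; xpoly : {poly K} }.

Definition quad_twist (K : fieldType) (D : K) (E : curve K) : curve K :=
  Curve (D * ycoef E) (xpoly E).

Definition j0_curve (K : fieldType) (b : K) : curve K :=
  Curve 1 ('X^3 + b%:P).

Section MordellWeil.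
Variables (K : fieldType) (E : curve K).
Let D := ycoef E.
Let f := xpoly E.

(* [None] is the point at infinity. *)
Definition ec_point := option (K * K).

Definition on_curve (P : ec_point) : bool :=
  if P is Some (x, y) then D * y ^+ 2 == f.[x] else true.

Definition ec_opp (P : ec_point) : ec_point :=
  if P is Some (x, y) then Some (x, - y) else None.

(* Chord-tangent addition: the line y = m * x + c meets the curve in three
   points whose abscissas add up to (D * m^2 - f_2) / f_3. *)
Definition ec_add (P Q : ec_point) : ec_point :=
  match P, Q with
  | None, _ => Q
  | _, None => P
  | Some (x1, y1), Some (x2, y2) =>
      if (x1 == x2) && (y1 == - y2) then None else
      let m := if x1 == x2 then f^`().[x1] / (2 * D * y1)
               else (y2 - y1) / (x2 - x1) in
      let x3 := (D * m ^+ 2 - f`_2) / f`_3 - x1 - x2 in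
      Some (x3, m * (x1 - x3) - y1)
  end.

Definition ec_mulz (n : int) (P : ec_point) : ec_point :=
  match n with
  | Posz k => iter k (ec_add P) None
  | Negz k => ec_opp (iter k.+1 (ec_add P) None)
  end.

Definition ec_independent (n : nat) (P : 'I_n -> ec_point) : Prop :=
  forall c : 'I_n -> int,
    \big[ec_add/None]_(i < n) ec_mulz (c i) (P i) = None -> forall i, c i = 0.

(* The rank of the group of K-rational points: the supremum of the sizes of its
   finite Z-linearly independent families.  It is extended-valued so that the
   definition does not presuppose the Mordell-Weil theorem. *)
Definition mw_rank : \bar Rdefinitions.R :=
  ereal_sup [set (n%:R)%:E | n in
    [set n : nat | exists P : 'I_n -> ec_point,
                     (forall i, on_curve (P i)) /\ ec_independent P]].

End MordellWeil.

(* Equality of the images of D and D' in the quotient of the group of units of K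
   by its squares. *)
Definition same_square_class (K : fieldType) (D D' : K) : Prop :=
  exists2 c : K, c != 0 & D = D' * c ^+ 2.

(* Main.v *)
Require Import Defs.
From mathcomp Require Import all_boot all_order all_algebra all_field.
From mathcomp Require Import boolp classical_sets cardinality.
From mathcomp Require Import reals constructive_ereal ereal Rstruct.
From mathcomp Require Import zify ring.

Import Order.TTheory GRing.Theory Num.Theory.
Local Open Scope classical_set_scope.
Local Open Scope ring_scope.

(* If x^3 + a = y^3 + b = D, then (x, 1) and (y, 1) lie on the twists by D of
   Y^2 = X^3 + a and Y^2 = X^3 + b. With a = lambda b1 and b = lambda b2, such pairs
   (x, y) form the cubic y^3 - x^3 = lambda (b1 - b2), and lambda is chosen so that this is
   (up to sign) the curve X^3 + Y^3 = 604 Z^3 with its rational point (-5 : 9 : 1). The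
   tangent process gives rational points (X_n : Y_n : Z_n) with 2^n | Z_n, X_n, Y_n odd.

   Positive rank. Once x has a large power of 2 in its denominator, the multiples of (x, 1)
   stay close to the origin 2-adically, and a suitable coordinate z satisfies
   z(nP) = n mod 2. So nP is not O for n odd; and if nP = O with n = 2m minimal, then
   iP = -(n - i)P for all i by induction on i, which only needs P - (P + Q) = -Q, so mP is
   2-torsion, which is impossible close to the origin.

   Square classes. Z_n is the product of the W_i = X_i^3 - Y_i^3, i < n, which are pairwise
   coprime away from 2, with W_i = 1 mod 5 and W_i/2 odd; hence +-W_i/2 is not a square and
   W_i has an odd prime factor p_i of odd valuation. So D = X_n^3/Z_n^3 + a has odd valuation
   at p_i for all n > i. For p_i large (unramified in K) this distinguishes the square class
   of D from that of any given element of K, as K has square roots of p_i * unit only if p_i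
   ramifies.

   Valuations of K are avoided: K is localised at p using the order of the elements that act
   on K by integral matrices. *)

(** * The order of integral elements and its localisations *)

(** A rank factorisation [M = C R] turns [M M = 0] into [R C = 0], and [M] has the same trace as
    [R C]. *)
Lemma mxtrace_sqr_eq0 (F : fieldType) n (M : 'M[F]_n) : M *m M = 0 -> \tr M = 0.
Proof.
have /row_fullP[B] := col_base_full M; have /row_freeP[B'] := row_base_free M.
rewrite -[in \tr _](mulmx_base M) -[in M *m M](mulmx_base M) mxtrace_mulC.
move: (row_base M) (col_base M) => R C RB BC CRCR.
suff -> : R *m C = 0 by rewrite mxtrace0.
have <- : B *m (C *m R *m (C *m R)) *m B' = R *m C.
  by rewrite !mulmxA BC mul1mx -mulmxA RB mulmx1.
by rewrite CRCR mulmx0 mul0mx.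
Qed.

Section RegularRepresentation.
Import VectorInternalTheory.
Variable K : fieldExtType rat.
Local Notation d := (dim K).

Definition mulrep (x : K) : 'M[rat]_d :=
  \matrix_(i, j) v2r (r2v (delta_mx 0 i) * x) 0 j.

Lemma mul_mulrep (v : 'rV[rat]_d) (x : K) : v *m mulrep x = v2r (r2v v * x).
Proof.
rewrite mulmx_sum_row [in RHS](row_sum_delta v).
rewrite linear_sum mulr_suml linear_sum; apply: eq_bigr => i _.
rewrite linearZ -scalerAl linearZ; congr (_ *: _).
by apply/rowP => j; rewrite !mxE.
Qed.

Lemma mulrep_inj_row (M N : 'M[rat]_d) : (forall v : 'rV_d, v *m M = v *m N) -> M = N.
Proof. by move=> e; apply/row_matrixP => i; rewrite !rowE e. Qed.

Lemma mulrepM x y : mulrep (x * y) = mulrep x *m mulrep y.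
Proof.
by apply: mulrep_inj_row => v; rewrite mulmxA !mul_mulrep v2rK mulrA.
Qed.

Lemma mulrepD x y : mulrep (x + y) = mulrep x + mulrep y.
Proof.
by apply: mulrep_inj_row => v; rewrite mulmxDr !mul_mulrep mulrDr linearD.
Qed.

Lemma mulrepZ (q : rat) x : mulrep (q *: x) = q *: mulrep x.
Proof.
by apply: mulrep_inj_row => v; rewrite -scalemxAr !mul_mulrep -scalerAr linearZ.
Qed.

Lemma mulrep0 : mulrep 0 = 0.
Proof. by rewrite -(scale0r 1) mulrepZ scale0r. Qed.

Lemma mulrep1 : mulrep 1 = 1%:M.
Proof. by apply: mulrep_inj_row => v; rewrite mul_mulrep mulr1 r2vK mulmx1. Qed.

Lemma mulrep_scalar (q : rat) : mulrep q%:A = q%:M.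
Proof. by rewrite mulrepZ mulrep1 scalemx1. Qed.

Lemma mulrep_natl (n : nat) x : mulrep (n%:R * x) = n%:R *: mulrep x.
Proof. by rewrite -mulrepZ mulr_natl scaler_nat. Qed.

Lemma dim_gt0 : (0 < d)%N.
Proof.
rewrite lt0n; apply/eqP => d0.
have: (1 : K) = 0; last by apply/eqP/oner_neq0.
apply: (can_inj v2rK); apply/rowP => i; case: i => i Hi; exfalso.
by move: Hi; rewrite d0.
Qed.

(** The multiplier ring of the lattice spanned by the chosen basis: an order of [K], not necessarily
    the maximal one. *)
Definition integral_elt (x : K) := exists N : 'M[int]_d, map_mx intr N = mulrep x.

(* The localisation at [p] of the order of elements that act by integral matrices. *)
Definition pint (p : nat) (x : K) :=
  exists2 s : nat, ~~ (p %| s)%N & integral_elt (s%:R * x).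

Lemma integral_eltD x y : integral_elt x -> integral_elt y -> integral_elt (x + y).
Proof.
by move=> [M eM] [N eN]; exists (M + N); rewrite map_mxD eM eN mulrepD.
Qed.

Lemma integral_eltM x y : integral_elt x -> integral_elt y -> integral_elt (x * y).
Proof.
by move=> [M eM] [N eN]; exists (M *m N); rewrite map_mxM eM eN mulrepM.
Qed.

Lemma integral_elt_int (z : int) : integral_elt z%:~R.
Proof.
exists z%:M; rewrite map_scalar_mx -mulrep_scalar; congr mulrep.
by rewrite scaler_int.
Qed.

Lemma integral_elt_nat (n : nat) : integral_elt n%:R.
Proof. exact: (integral_elt_int n). Qed.

Lemma integral_elt_rat (q : rat) : integral_elt q%:A -> exists z : int, q = z%:~R.
Proof.
case=> N; rewrite mulrep_scalar => /matrixP eN.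
pose i := Ordinal dim_gt0.
by exists (N i i); move: (eN i i); rewrite !mxE eqxx mulr1n.
Qed.

Lemma integral_elt_clear x : exists2 n : nat, (0 < n)%N & integral_elt (n%:R * x).
Proof.
pose den := \prod_(ij : 'I_d * 'I_d) `|denq (mulrep x ij.1 ij.2)|%N.
have den_int i j : exists z : int, den%:R * mulrep x i j == z%:~R.
  rewrite /den (bigD1 (i, j)) //= natrM.
  set q := mulrep x i j; set r := (\prod_(_ | _) _)%N.
  exists (r%:Z * numq q); rewrite rmorphM /= numqE -pmulrn.
  rewrite -[X in X * _ * q]/((`|denq q|%N : int)%:~R) gez0_abs ?denq_ge0 //.
  by apply/eqP; ring.
exists den.
  by rewrite prodn_gt0 // => ij; rewrite absz_gt0 denq_neq0.
exists (\matrix_(i, j) xchoose (den_int i j)); rewrite mulrep_natl.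
apply/matrixP => i j; rewrite [LHS]mxE [in LHS]mxE [RHS]mxE.
exact/esym/eqP/(xchooseP (den_int i j)).
Qed.

Lemma natK_eq0 (n : nat) : ((n%:R : K) == 0) = (n == 0%N).
Proof. by rewrite -scaler_nat scaler_eq0 oner_eq0 orbF pnatr_eq0. Qed.

Lemma integral_elt_absz (z : int) x :
  integral_elt (z%:~R * x) -> integral_elt (`|z|%:R * x).
Proof.
case: z => n //= zx; rewrite -[_ * x]opprK -mulN1r.
apply: integral_eltM; first exact: (integral_elt_int (-1)).
by move: zx; rewrite NegzE rmorphN mulNr.
Qed.

Section Localisation.
Variable p : nat.
Hypothesis p_prime : prime p.

Lemma natp_neq0 : p%:R != 0 :> K.
Proof. by rewrite natK_eq0 -lt0n prime_gt0. Qed.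

Lemma pint_integral x : integral_elt x -> pint p x.
Proof. by exists 1%N; rewrite ?mul1r // Euclid_dvd1. Qed.

Lemma pint_nat (n : nat) : pint p n%:R.
Proof. exact/pint_integral/integral_elt_nat. Qed.

Lemma pint_int (z : int) : pint p z%:~R.
Proof. exact/pint_integral/integral_elt_int. Qed.

Lemma pintD x y : pint p x -> pint p y -> pint p (x + y).
Proof.
move=> [s ps sx] [t pt ty]; exists (s * t)%N; first by rewrite Euclid_dvdM // negb_or ps.
have -> : (s * t)%:R * (x + y) = t%:R * (s%:R * x) + s%:R * (t%:R * y).
  by rewrite natrM; ring.
by apply: integral_eltD; apply: integral_eltM => //; apply: integral_elt_nat.
Qed.

Lemma pintM x y : pint p x -> pint p y -> pint p (x * y).
Proof.
move=> [s ps sx] [t pt ty]; exists (s * t)%N; first by rewrite Euclid_dvdM // negb_or ps.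
have -> : (s * t)%:R * (x * y) = (s%:R * x) * (t%:R * y) by rewrite natrM; ring.
exact: integral_eltM.
Qed.

Lemma pintN x : pint p x -> pint p (- x).
Proof. by move=> px; rewrite -mulN1r; apply: pintM => //; apply: (pint_int (-1)). Qed.

Lemma pintB x y : pint p x -> pint p y -> pint p (x - y).
Proof. by move=> px /pintN; apply: pintD. Qed.

Lemma pintX x n : pint p x -> pint p (x ^+ n).
Proof.
move=> px; elim: n => [|n IH]; first exact: (pint_nat 1).
by rewrite exprS; apply: pintM.
Qed.

Lemma pint_sum (I : finType) (F : I -> K) :
  (forall i, pint p (F i)) -> pint p (\sum_i F i).
Proof.
by move=> pF; elim/big_ind: _ => //; [exact: (pint_nat 0)|exact: pintD].
Qed.

Lemma pint_invn (n : nat) : ~~ (p %| n)%N -> pint p n%:R^-1.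
Proof.
move=> pn; exists n => //; rewrite divff; first exact: (integral_elt_nat 1).
by rewrite natK_eq0; apply: contraNneq pn => ->.
Qed.

Lemma pint_invz (z : int) : ~~ (p %| z)%Z -> pint p z%:~R^-1.
Proof.
case: z => n pn; first exact: pint_invn.
by rewrite NegzE rmorphN invrN; apply/pintN/pint_invn.
Qed.

Lemma pint_invp : ~ pint p (p%:R^-1).
Proof.
move=> [s ps spi]; move/negP: ps; apply.
have: integral_elt ((s%:R / p%:R : rat)%:A).
  by rewrite -[_%:A]/(in_alg K _) fmorph_div !rmorph_nat.
case/integral_elt_rat => z sz.
have p0 : p%:R != 0 :> rat by rewrite pnatr_eq0 -lt0n prime_gt0.
have: s%:Z = z * p%:Z.
  by apply/eqP; rewrite -(eqr_int rat) rmorphM /= -!pmulrn -sz divfK.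
by move/(congr1 absz); rewrite abszM /= => ->; rewrite dvdn_mull.
Qed.

Lemma pint_clear x : exists k, pint p (p%:R ^+ k * x).
Proof.
have [n n0 nx] := integral_elt_clear x.
have [m pm en] := pfactor_coprime p_prime n0.
exists (logn p n), m; first by rewrite -prime_coprime.
by rewrite mulrA -natrX -natrM -en.
Qed.

(** With [s * x] integral, [s * (1 + p * x)] acts by an integral matrix congruent to [s] modulo [p],
    so its determinant is prime to [p] and the adjugate provides the inverse. *)
Lemma pint_1pM_unit x : pint p x -> 1 + p%:R * x != 0 /\ pint p (1 + p%:R * x)^-1.
Proof.
move=> [s ps [N eN]]; pose M : 'M[int]_d := s%:Z%:M + p%:Z *: N.
set y := 1 + _; pose z := s%:R * y.
have eM : map_mx intr M = mulrep z.
  have -> : z = s%:R * 1 + p%:R * (s%:R * x) by rewrite /z /y; ring.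
  rewrite mulrepD !mulrep_natl mulrep1 scalemx1 -mulrep_natl -eN.
  by rewrite map_mxD map_scalar_mx map_mxZ.
have pdet : ~~ (p %| \det M)%Z.
  have: ((\det M)%:~R : 'F_p) != 0.
    rewrite -det_map_mx map_mxD map_scalar_mx map_mxZ /=.
    rewrite -[(p%:Z)%:~R]/(p%:R) pchar_Fp_0 // scale0r addr0 det_scalar expf_neq0 //.
    by rewrite -[(s%:Z)%:~R]/(s%:R) -(dvdn_pcharf (pchar_Fp p_prime)).
  apply: contraNN => /dvdzP[q ->].
  by rewrite rmorphM /= -[(p%:Z)%:~R]/(p%:R) pchar_Fp_0 // mulr0.
have adjM : map_mx intr (\adj M) *m mulrep z = ((\det M)%:~R)%:M :> 'M[rat]__.
  by rewrite -eM -map_mxM mul_adj_mx map_scalar_mx.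
have z0 : z != 0.
  apply: contraNneq pdet => z0; move: adjM; rewrite z0 -(scale0r 1) mulrep_scalar.
  rewrite mul_mx_scalar scale0r => /matrixP/(_ (Ordinal dim_gt0) (Ordinal dim_gt0)).
  rewrite !mxE eqxx mulr1n => /esym/eqP; rewrite intr_eq0 => /eqP ->.
  exact: dvdz0.
have y0 : y != 0 by apply: contraNneq z0; rewrite /z => ->; rewrite mulr0.
split=> //.
have s0 : s%:R != 0 :> K by rewrite natK_eq0; apply: contraNneq ps => ->.
have -> : y^-1 = s%:R * z^-1 by rewrite /z invfM mulrA divff // mul1r.
apply: pintM; first exact: pint_nat.
exists `|\det M|%N; first by rewrite /dvdz in pdet.
apply: integral_elt_absz; exists (\adj M).
rewrite -[LHS]mulmx1 -mulrep1 -(divff z0) mulrepM mulmxA adjM mul_scalar_mx.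
by rewrite -mulrepZ -mulr_algl scaler_int divff.
Qed.

End Localisation.

(** * Trace form and ramification *)

Lemma pint_large x : exists B, forall p, prime p -> (B < p)%N -> pint p x.
Proof.
have [n n0 nx] := integral_elt_clear x; exists n => p _ np.
by exists n => //; rewrite gtnNdvd.
Qed.

(** Up to a factor prime to [p], [x] acts by an integral matrix whose square vanishes modulo [p], so
    its trace vanishes modulo [p]. *)
Lemma pint_trace p x : prime p -> pint p x -> pint p (x ^+ 2 / p%:R) ->
  pint p (\tr (mulrep x) / p%:R)%:A.
Proof.
move=> p_prime [s ps [N eN]] [t pt [T eT]].
have p0 : p%:R != 0 :> K by exact: natp_neq0.
pose M : 'M[int]_d := t%:Z *: N.
have eM : map_mx intr M = mulrep ((t * s)%:R * x).
  by rewrite natrM -mulrA mulrep_natl -eN map_mxZ.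
have M2 : M *m M = (p * (t * s * s))%:Z *: T.
  suff eM2 : map_mx intr (M *m M) = map_mx intr ((p * (t * s * s))%:Z *: T) :> 'M[rat]_d.
    apply/matrixP => i j; apply: (@intr_inj rat).
    by move/matrixP/(_ i j): eM2; rewrite [LHS]mxE [RHS]mxE.
  rewrite map_mxM eM -mulrepM map_mxZ eT /= -[(_%:Z)%:~R]/((p * (t * s * s))%:R) -mulrep_natl.
  by congr mulrep; rewrite !natrM; field.
have /dvdzP[z trM] : (p %| \tr M)%Z.
  have tr0 : \tr (map_mx intr M : 'M['F_p]_d) = 0.
    apply: mxtrace_sqr_eq0; rewrite -map_mxM M2 map_mxZ PoszM rmorphM /=.
    by rewrite -[(p%:Z)%:~R]/(p%:R) pchar_Fp_0 // mul0r scale0r.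
  move: tr0; rewrite trace_map_mx; move: (\tr M) => z.
  case: z => n; rewrite ?NegzE ?rmorphN /= => /eqP; rewrite ?oppr_eq0 -pmulrn.
    by rewrite -(dvdn_pcharf (pchar_Fp p_prime)).
  by rewrite -(dvdn_pcharf (pchar_Fp p_prime)) /dvdz /=.
exists (t * s)%N; first by rewrite Euclid_dvdM // negb_or pt.
have -> : (t * s)%:R * (\tr (mulrep x) / p%:R)%:A = z%:~R :> K.
  rewrite mulr_natl scalerMnl -[_ *+ (t * s)]mulr_natl mulrA -mxtraceZ -mulrep_natl -eM.
  rewrite trace_map_mx trM rmorphM /= -pmulrn mulfK ?scaler_int //.
  by rewrite pnatr_eq0 -lt0n prime_gt0.
exact: integral_elt_int.
Qed.

Definition trace_form : 'M[rat]_d :=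
  \matrix_(i, j) \tr (mulrep (r2v (delta_mx 0 i) * r2v (delta_mx 0 j))).

Lemma mul_trace_form (c : K) j :
  (v2r c *m trace_form) 0 j = \tr (mulrep (c * r2v (delta_mx 0 j))).
Proof.
rewrite -[in RHS](v2rK c) [in RHS](row_sum_delta (v2r c)) linear_sum mulr_suml.
rewrite mxE (big_morph mulrep mulrepD mulrep0).
rewrite linear_sum; apply: eq_bigr => i _.
by rewrite mxE linearZ -scalerAl mulrepZ /= mxtraceZ.
Qed.

(** If [c != 0] lay in the radical, then [c * c^-1 = 1] would have trace [0], whereas its trace is
    the degree of [K]. *)
Lemma trace_form_unit : trace_form \in unitmx.
Proof.
rewrite -row_free_unit -kermx_eq0; apply/rowV0P => v /sub_kermxP vT0.
apply/eqP/negP => /negP v0; pose c : K := r2v v.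
have c0 : c != 0.
  by apply: contraNneq v0 => c0; rewrite -(r2vK v) -/c c0 linear0.
have tr0 y : \tr (mulrep (c * y)) = 0.
  rewrite -(v2rK y) (row_sum_delta (v2r y)) linear_sum mulr_sumr.
  rewrite (big_morph mulrep mulrepD mulrep0).
  rewrite linear_sum big1 // => i _.
  rewrite linearZ -scalerAr mulrepZ /= mxtraceZ -mul_trace_form r2vK vT0.
  by rewrite mxE mulr0.
have := tr0 c^-1; rewrite divff // mulrep1 mxtrace1 => /eqP.
by rewrite pnatr_eq0 eqn0Ngt dim_gt0.
Qed.

Lemma eventually_pint (I : finType) (F : I -> K) :
  exists B, forall p, prime p -> (B < p)%N -> forall i, pint p (F i).
Proof.
have [B BP] := choice (fun i => pint_large (F i)).
exists (\max_i B i) => p pp Bp i; apply: BP => //.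
exact: leq_ltn_trans (leq_bigmax i) Bp.
Qed.

(* Almost every [p] is unramified: the trace form is nondegenerate modulo [p], while
   nilpotents modulo [p] have trace [0]. *)
Lemma pint_reduced : exists B, forall p, prime p -> (B < p)%N ->
  forall c, pint p c -> pint p (c ^+ 2 / p%:R) -> pint p (c / p%:R).
Proof.
pose e (i : 'I_d) : K := r2v (delta_mx 0 i).
have [B1 e_int] := eventually_pint _ e.
have [B2 T_int] := eventually_pint _ (fun ij : 'I_d * 'I_d => (invmx trace_form ij.1 ij.2)%:A).
exists (maxn B1 B2) => p pp; rewrite gtn_max => /andP[Bp1 Bp2] c cp c2p.
have {}e_int i := e_int p pp Bp1 i; have {}T_int i j := T_int p pp Bp2 (i, j).
(* [c * e j] is again integral with square divisible by [p], so [p] divides its trace. *)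
have tr_int j : pint p (\tr (mulrep (c * e j)) / p%:R)%:A.
  apply: pint_trace => //; first exact: pintM.
  rewrite exprMn mulrAC; apply: pintM => //; exact: pintX.
(* The inverse Gram matrix, integral at [p], recovers the coordinates of [c] from these traces. *)
have coord_int i : pint p (v2r c 0 i / p%:R)%:A.
  rewrite -[v2r c](mulmxK trace_form_unit) mxE mulr_suml scaler_suml.
  apply: pint_sum => // j; rewrite mul_trace_form mulrAC -[_%:A]/(in_alg K _) rmorphM.
  by apply: pintM => //; [exact: tr_int|exact: T_int].
rewrite -(v2rK c) (row_sum_delta (v2r c)) linear_sum mulr_suml.
apply: pint_sum => // i; rewrite linearZ.
have -> : v2r c 0 i *: r2v (delta_mx 0 i) / p%:R = (v2r c 0 i / p%:R)%:A * e i.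
  rewrite -[in RHS]/(in_alg K _) fmorph_div rmorph_nat /= -scalerAl /e.
  by rewrite -!scalerAl mul1r mulrC.
by apply: pintM.
Qed.

(** Such a [c] yields [b] with [b ^+ 2 = p * u]. At an unramified [p] this makes [b], then [b / p],
    integral, and [(b / p) ^+ 2 / u] is [1 / p]. *)
Lemma pint_not_sqr : exists B, forall p, prime p -> (B < p)%N ->
  forall k c u, odd k -> u != 0 -> pint p u -> pint p u^-1 -> p%:R ^+ k * c ^+ 2 <> u.
Proof.
have [B BP] := pint_reduced; exists B => p pp Bp k c u k_odd u0 u_int uV_int eu.
have p0 := natp_neq0 p pp.
pose b := p%:R ^+ (k.+1)./2 * c.
have eb : b ^+ 2 = p%:R * u.
  rewrite -eu mulrA -exprS exprMn -exprM; congr (_ ^+ _ * _).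
  by rewrite muln2 -[RHS]odd_double_half /= k_odd.
have [j pj] := pint_clear p pp b.
(* Factors [p] leave the denominator of [b] one at a time, since the square of [p ^ (j + 1) * b] is
   divisible by [p]. *)
have b_int : pint p b.
  elim: j pj => [|j IH]; rewrite ?expr0 ?mul1r // => pj; apply: IH.
  have -> : p%:R ^+ j * b = p%:R ^+ j.+1 * b / p%:R by rewrite exprS; field.
  apply: BP => //.
  have -> : (p%:R ^+ j.+1 * b) ^+ 2 / p%:R = p%:R ^+ (j.+1 * 2) * u.
    by rewrite exprMn eb exprM; field.
  by apply: pintM => //; rewrite -natrX; apply: pint_nat.
have bp_int : pint p (b / p%:R).
  by apply: BP => //; rewrite eb mulrAC divff // mul1r.
apply: (pint_invp p pp).
have -> : p%:R^-1 = (b / p%:R) ^+ 2 * u^-1 :> K by rewrite expr_div_n eb; field; rewrite u0 p0.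
by apply: pintM => //; apply: pintX.
Qed.

End RegularRepresentation.

(** * Chords and tangents on [D y^2 = x^3 + a] *)

Section ChordTangent.
Context {K : fieldType} {D a : K}.
Hypotheses (two_neq0 : 2 != 0 :> K) (D0 : D != 0).
Local Notation E := (quad_twist D (j0_curve a)).

Lemma on_curveE x y : on_curve E (Some (x, y)) = (D * y ^+ 2 == x ^+ 3 + a).
Proof. by rewrite /= mulr1 !hornerE. Qed.

(* The last equation says that the line [y = mu * x + ka] has the right slope, also
   when the two points coincide. *)
Definition chord mu ka x1 y1 x2 y2 :=
  [/\ y1 = mu * x1 + ka, y2 = mu * x2 + ka
    & D * mu * (y1 + y2) = x1 ^+ 2 + x1 * x2 + x2 ^+ 2 :> K].

(** On a chord equal abscissas force [y1 = y2]; then [y1 != 0] keeps [ec_add] out of its branch for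
    opposite points. *)
Lemma ec_add_chord mu ka x1 y1 x2 y2 : y1 != 0 -> chord mu ka x1 y1 x2 y2 ->
  ec_add E (Some (x1, y1)) (Some (x2, y2)) =
    let x3 := D * mu ^+ 2 - x1 - x2 in Some (x3, - (mu * x3 + ka)).
Proof.
move=> y10 [e1 e2 e3] /=; rewrite mulr1.
have -> : ('X^3 + a%:P)`_2 = 0 by rewrite coefD coefXn coefC addr0.
have -> : ('X^3 + a%:P)`_3 = 1 by rewrite coefD coefXn coefC addr0.
have -> : ('X^3 + a%:P)^`().[x1] = 3 * x1 ^+ 2.
  by rewrite derivD derivC derivXn addr0 hornerMn hornerXn mulr_natl.
case: eqP => [x12|/eqP x12] /=.
  have y12 : y2 = y1 by rewrite e1 e2 x12.
  have y1N : y1 != - y1 by rewrite -addr_eq0 -mulr2n -mulr_natl mulf_neq0.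
  rewrite y12 (negPf y1N) -x12.
  have -> : 3 * x1 ^+ 2 / (2 * D * y1) = mu.
    have -> : 3 * x1 ^+ 2 = mu * (2 * D * y1).
      move: e3; rewrite y12 -x12 => e3.
      have -> : mu * (2 * D * y1) = D * mu * (y1 + y1) by ring.
      by rewrite e3; ring.
    by rewrite mulfK // !mulf_neq0.
  by rewrite subr0 divr1; congr (Some (_, _)); rewrite e1; ring.
have -> : (y2 - y1) / (x2 - x1) = mu.
  rewrite e1 e2; field; by rewrite subr_eq0 eq_sym.
by rewrite subr0 divr1; congr (Some (_, _)); rewrite e1; ring.
Qed.

Lemma chord_exists x1 y1 x2 y2 :
  on_curve E (Some (x1, y1)) -> on_curve E (Some (x2, y2)) ->
  ~~ ((x1 == x2) && (y1 == - y2)) -> exists mu ka, chord mu ka x1 y1 x2 y2.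
Proof.
rewrite !on_curveE => /eqP c1 /eqP c2; have [x12|x12] /= := eqVneq x1 x2.
  move: c2; rewrite -x12 => c2 y12; have ey : y2 = y1.
    have y12' : y1 + y2 != 0 by rewrite addr_eq0.
    apply: (mulIf y12'); apply: (mulfI D0).
    transitivity (D * y2 ^+ 2 + D * y1 * y2); first by ring.
    by rewrite c2 -c1; ring.
  move: y12; rewrite ey -addr_eq0 -mulr2n -mulr_natl mulf_eq0 negb_or => /andP[_ y10].
  pose mu := 3 * x1 ^+ 2 / (2 * D * y1).
  exists mu, (y1 - mu * x1); split; [by ring|by ring|].
  by rewrite /mu; field; rewrite ?two_neq0 ?D0 ?y10.
move=> _; pose mu := (y2 - y1) / (x2 - x1).
have x12' : x2 - x1 != 0 by rewrite subr_eq0 eq_sym.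
exists mu, (y1 - mu * x1); split; [by ring|by rewrite /mu; field|].
apply: (mulfI x12'); rewrite /mu.
have -> : (x2 - x1) * (D * ((y2 - y1) / (x2 - x1)) * (y1 + y2)) = D * y2 ^+ 2 - D * y1 ^+ 2.
  by field.
by rewrite c1 c2; ring.
Qed.

Section Chord.
Variables (mu ka x1 y1 x2 y2 : K).
Hypothesis c12 : chord mu ka x1 y1 x2 y2.
Hypothesis on1 : on_curve E (Some (x1, y1)).
Hypothesis on2 : on_curve E (Some (x2, y2)).
Let x3 := D * mu ^+ 2 - x1 - x2.
Let y3 := - (mu * x3 + ka).

(** With the ordinates eliminated, the hypotheses become three polynomial relations. The identities
    below are explicit combinations of them, checked by [ring]. *)
Let e1 : D * (mu * x1 + ka) ^+ 2 - x1 ^+ 3 - a = 0.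
Proof. by case: c12 => <- _ _; move: on1; rewrite on_curveE => /eqP ->; ring. Qed.

Let e2 : D * (mu * x2 + ka) ^+ 2 - x2 ^+ 3 - a = 0.
Proof. by case: c12 => _ <- _; move: on2; rewrite on_curveE => /eqP ->; ring. Qed.

Let e3 : D * mu * (mu * x1 + ka + (mu * x2 + ka)) - (x1 ^+ 2 + x1 * x2 + x2 ^+ 2) = 0.
Proof. by case: c12 => <- <- ->; ring. Qed.

Lemma chord_on_curve : on_curve E (Some (x3, y3)).
Proof.
rewrite on_curveE -subr_eq0; apply/eqP.
transitivity ((D * (mu * x1 + ka) ^+ 2 - x1 ^+ 3 - a) + (x3 - x1) *
  (D * mu * (mu * x1 + ka + (mu * x2 + ka)) - (x1 ^+ 2 + x1 * x2 + x2 ^+ 2))).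
  by rewrite /y3 /x3; ring.
by rewrite e1 e3 mulr0 addr0.
Qed.

Lemma chord_third : chord mu ka x1 y1 x3 (- y3).
Proof.
case: c12 => ey1 _ _; split=> //; first by rewrite opprK.
apply/eqP; rewrite -subr_eq0; apply/eqP; rewrite opprK ey1 -e3 /x3; ring.
Qed.

(* In the coordinates z = x / y, w = 1 / y at the origin this expresses the slope of the line
   by a fraction whose denominator does not vanish near the origin. *)
Lemma chord_slope :
  - mu * (D * y1 ^+ 2 * y2 ^+ 2 - a * (y1 ^+ 2 + y1 * y2 + y2 ^+ 2)) =
  ka * (x1 ^+ 2 * y2 ^+ 2 + x1 * x2 * y1 * y2 + x2 ^+ 2 * y1 ^+ 2).
Proof.
case: c12 => ey1 ey2 _; apply/eqP; rewrite -subr_eq0; apply/eqP.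
transitivity (y1 ^+ 2 * y2 *
  (D * mu * (mu * x1 + ka + (mu * x2 + ka)) - (x1 ^+ 2 + x1 * x2 + x2 ^+ 2))
  - mu * ((D * (mu * x2 + ka) ^+ 2 - x2 ^+ 3 - a) * y1 ^+ 2 +
     (D * (mu * x1 + ka) ^+ 2 - x1 ^+ 3 - a) * (y2 ^+ 2 + y1 * y2))).
  by rewrite ey1 ey2; ring.
by rewrite e1 e2 e3; ring.
Qed.

(** Vieta for the cubic in [y] obtained by eliminating [x]; the third point of the line has ordinate
    [- y3]. *)
Lemma chord_prod_y : - (y1 * y2 * y3) = ka ^+ 3 - a * mu ^+ 3.
Proof.
case: c12 => ey1 ey2 _; apply/eqP; rewrite -subr_eq0; apply/eqP.
transitivity (y1 * mu ^+ 2 *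
  (D * mu * (mu * x1 + ka + (mu * x2 + ka)) - (x1 ^+ 2 + x1 * x2 + x2 ^+ 2))
  - mu ^+ 3 * (D * (mu * x1 + ka) ^+ 2 - x1 ^+ 3 - a)).
  by rewrite /y3 /x3 ey1 ey2; ring.
by rewrite e1 e3; ring.
Qed.

(** Divided by [- (y1 * y2 * y3)], the left side is the sum of [x / y] over the three points of the
    line. So [x / y] is additive up to a term controlled by [a]. *)
Lemma chord_sum_z : x3 * y1 * y2 - x1 * y2 * y3 - x2 * y1 * y3 = - 3 * a * mu ^+ 2.
Proof.
case: c12 => ey1 ey2 _; apply/eqP; rewrite -subr_eq0; apply/eqP.
transitivity (mu * (3 * y1 - ka) *
  (D * mu * (mu * x1 + ka + (mu * x2 + ka)) - (x1 ^+ 2 + x1 * x2 + x2 ^+ 2))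
  - 3 * mu ^+ 2 * (D * (mu * x1 + ka) ^+ 2 - x1 ^+ 3 - a)).
  by rewrite /y3 /x3 ey1 ey2; ring.
by rewrite e1 e3; ring.
Qed.

End Chord.

(** The line through P and Q also contains -(P + Q), so P and -(P + Q) span the same line, whose
    remaining point is Q. *)
Lemma ec_add_cancel x1 y1 Q : y1 != 0 ->
  on_curve E (Some (x1, y1)) -> on_curve E Q ->
  ec_add E (Some (x1, y1)) (ec_opp (ec_add E (Some (x1, y1)) Q)) = ec_opp Q.
Proof.
move=> y10 on1; case: Q => [[x2 y2]|] on2; last first.
  by rewrite /= eqxx opprK eqxx.
have [opp|nopp] := boolP ((x1 == x2) && (y1 == - y2)).
  by rewrite {2}/ec_add opp /=; case/andP: opp => /eqP -> /eqP ->.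
have [mu [ka c12]] := chord_exists _ _ _ _ on1 on2 nopp.
rewrite (ec_add_chord _ _ _ _ _ _ y10 c12) /=; have c13 := chord_third _ _ _ _ _ _ c12.
rewrite [LHS](ec_add_chord _ _ _ _ _ _ y10 c13); case: c12 => ey1 ey2 _.
by congr (Some (_, _)); rewrite ?ey2; ring.
Qed.

End ChordTangent.

(** * Points of infinite order *)

Section NonTorsion.
Context {K : fieldExtType rat} {a x : K}.
Hypotheses (x0 : x != 0) (a_small : pint K 2 (a / x ^+ 3 / 2)).
Let D := x ^+ 3 + a.
Local Notation E := (quad_twist D (j0_curve a)).
Local Notation int2 := (pint K 2).
Let e := a / x ^+ 3 / 2.
Let pr2 : prime 2 := isT.
Let two_neq0 : 2 != 0 :> K := natp_neq0 K 2 pr2.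

Let aE : a = 2 * e * x ^+ 3.
Proof. by rewrite /e; field; rewrite x0 two_neq0. Qed.

Let DE : D = x ^+ 3 * (1 + 2 * e).
Proof. by rewrite /D {1}aE; ring. Qed.

Lemma twist_coef_neq0 : D != 0.
Proof.
by rewrite DE mulf_neq0 ?expf_neq0 //; case: (pint_1pM_unit K 2 pr2 e a_small).
Qed.
Let D0 := twist_coef_neq0.

(* Coordinates at the origin of [E], scaled so that [(x, 1)] becomes [(1, 1)]; the curve
   is [(1 + 2 e) w = z ^ 3 + 2 e w ^ 3]. *)
Definition zcoord (P : ec_point K) := if P is Some (X, Y) then X / (x * Y) else 0.
Definition wcoord (P : ec_point K) := if P is Some (_, Y) then Y^-1 else 0.

(** The ordinate must be nonzero because [zcoord] and [wcoord] would otherwise hide a division by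
    zero; this excludes points of order 2. *)
Definition near_origin (k : K) (P : ec_point K) :=
  [/\ on_curve E P, (if P is Some (_, Y) then Y != 0 else true),
      int2 (wcoord P) & int2 ((zcoord P - k) / 2)].

(** In the coordinates (z, w) the chord becomes w = m z + 1 / ka. Both coefficients are integral,
    and z is additive up to an even correction. *)
Lemma near_add k l P Q : int2 k -> int2 l ->
  near_origin k P -> near_origin l Q -> near_origin (k + l) (ec_add E P Q).
Proof.
move=> k_int l_int [onP yP wP zP] [onQ yQ wQ zQ].
have int_z m R : int2 m -> int2 ((zcoord R - m) / 2) -> int2 (zcoord R).
  move=> m_int zR; have -> : zcoord R = 2 * ((zcoord R - m) / 2) + m by field.
  by apply: pintD => //; apply: pintM => //; apply: (pint_nat K 2 pr2 2).
have {int_z} [zP_int zQ_int] := (int_z k P k_int zP, int_z l Q l_int zQ).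
have zPQ : int2 ((zcoord P + zcoord Q - (k + l)) / 2).
  by rewrite opprD addrACA mulrDl; apply: pintD.
case: P onP yP wP zP zP_int zPQ => [[x1 y1]|]; last first.
  move=> _ _ _ _ _; rewrite [zcoord None]/= add0r => zPQ; split=> //.
case: Q onQ yQ wQ zQ zQ_int => [[x2 y2]|]; last first.
  move=> _ _ _ _ _ onP yP wP zP _; rewrite [zcoord None]/= addr0 => zPQ; split=> //.
move=> on2 y20 w2 _ z2 on1 y10 w1 _ z1 z12.
(* For opposite points the z-coordinates cancel, so [zPQ] says that 2 divides [k + l], as the origin
   requires. *)
have [opp|nopp] := boolP ((x1 == x2) && (y1 == - y2)).
  rewrite /near_origin {1 2 3 4}/ec_add opp; split=> //; first exact: (pint_nat K 2 pr2 0).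
  move: z12; congr (int2 ((_ - _) / 2)); case/andP: opp => /eqP -> /eqP ->.
  by rewrite /zcoord mulrN invrN mulrN addNr.
have [mu [ka c12]] := chord_exists two_neq0 D0 _ _ _ _ on1 on2 nopp.
have on3 := chord_on_curve _ _ _ _ _ _ c12 on1.
have slope := chord_slope _ _ _ _ _ _ c12 on1 on2.
have prod_y := chord_prod_y _ _ _ _ _ _ c12 on1.
have sum_z := chord_sum_z _ _ _ _ _ _ c12 on1.
rewrite (ec_add_chord two_neq0 D0 _ _ _ _ _ _ y10 c12); case: c12 => ey1 _ _.
move: on3 prod_y sum_z => /=.
set x3 := D * mu ^+ 2 - x1 - x2; set y3 := - (mu * x3 + ka) => on3 prod_y sum_z.
have y3E : y3 = - (mu * x3 + ka) by [].
clearbody y3; clearbody x3.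
rewrite /zcoord /= in z1 z2 z12; rewrite /wcoord /= in w1 w2.
set za := x1 / (x * y1) in z1 z12; set zb := x2 / (x * y2) in z2 z12.
pose W := y1^-1 ^+ 2 + y1^-1 * y2^-1 + y2^-1 ^+ 2.
pose S := za ^+ 2 + za * zb + zb ^+ 2.
(* The slope in (z, w), read off from [chord_slope]; its denominator is 1 modulo 2, hence a unit. *)
pose m := S / (1 + 2 * (e * (1 - W))).
have e_int : int2 e by [].
have one_int : int2 1 := pint_nat K 2 pr2 1.
have [den0 den_int] : 1 + 2 * (e * (1 - W)) != 0 /\ int2 (1 + 2 * (e * (1 - W)))^-1.
  apply: pint_1pM_unit => //; apply: pintM => //; apply: pintB => //.
  by rewrite /W; do 2?apply: pintD => //; rewrite ?expr2; apply: pintM.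
have m_int : int2 m.
  apply: pintM => //; rewrite /S; do 2?apply: pintD => //; rewrite ?expr2; exact: pintM.
have km : - (x * mu) = ka * m.
  have nz : x ^+ 2 * y1 ^+ 2 * y2 ^+ 2 * (1 + 2 * (e * (1 - W))) != 0.
    by rewrite !mulf_neq0 // expf_neq0.
  apply: (mulfI nz).
  transitivity (- mu * (D * y1 ^+ 2 * y2 ^+ 2 - a * (y1 ^+ 2 + y1 * y2 + y2 ^+ 2))).
    by rewrite DE aE /W; field; rewrite y10 y20.
  rewrite slope {1}/m; move: den0; set den := 1 + _ => den0.
  by rewrite /S /za /zb; field; rewrite ?den0 ?x0 ?y10 ?y20.
have ka0 : ka != 0.
  apply: contraNneq y10 => ka0; move: km; rewrite ka0 mul0r => /eqP.
  by rewrite oppr_eq0 mulf_eq0 (negPf x0) /= => /eqP mu0; rewrite ey1 ka0 mu0 mul0r addr0.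
have muE : mu = - (ka * m) / x by rewrite -km; field.
have c_int : int2 ka^-1.
  have -> : ka^-1 = y1^-1 - m * za.
    apply: (mulfI ka0); rewrite divff // mulrBr mulrA -km /za.
    have eka : ka = y1 - mu * x1 by rewrite ey1; ring.
    by rewrite {1}eka; field; rewrite y10 x0.
  by apply: pintB => //; apply: pintM.
have [E0 E_int] : 1 + 2 * (e * m ^+ 3) != 0 /\ int2 (1 + 2 * (e * m ^+ 3))^-1.
  by apply: pint_1pM_unit => //; apply: pintM => //; apply: pintX.
have prod_yE : - (y1 * y2 * y3) = ka ^+ 3 * (1 + 2 * (e * m ^+ 3)).
  by rewrite prod_y muE aE; field.
have y30 : y3 != 0.
  apply/eqP => y30; move/eqP: prod_yE; rewrite y30 mulr0 oppr0 eq_sym.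
  by rewrite (negPf (mulf_neq0 (expf_neq0 _ _) E0)).
(* Quotient of [chord_sum_z] by [chord_prod_y]; the factor 2 comes from [a = 2 * e * x ^+ 3]. *)
have zE : x3 / (x * y3) = za + zb + 2 * (3 * e * m ^+ 2 * ka^-1 / (1 + 2 * (e * m ^+ 3))).
  have nz : x * (y1 * y2 * y3) != 0 by rewrite !mulf_neq0.
  apply/eqP; rewrite -subr_eq0 -addrA opprD addrA opprD addrA subr_eq0; apply/eqP.
  apply: (mulfI nz).
  transitivity (x3 * y1 * y2 - x1 * y2 * y3 - x2 * y1 * y3).
    by rewrite /za /zb; field; rewrite x0 y10 y20 y30.
  rewrite sum_z -[y1 * y2 * y3]opprK prod_yE muE aE.
  by move: E0; set den := 1 + _ => E0; field; rewrite x0 ka0 E0.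
have corr_int : int2 (3 * e * m ^+ 2 * ka^-1 / (1 + 2 * (e * m ^+ 3))).
  do 3?apply: pintM => //; last exact: pintX.
  by apply: pintM => //; apply: (pint_nat K 2 pr2 3).
have z3_int : int2 ((x3 / (x * y3) - (k + l)) / 2).
  have -> : (x3 / (x * y3) - (k + l)) / 2 = (za + zb - (k + l)) / 2 +
      3 * e * m ^+ 2 * ka^-1 / (1 + 2 * (e * m ^+ 3)).
    by rewrite zE; set t := _ / (1 + 2 * (e * m ^+ 3)); field.
  exact: pintD.
split=> //=.
(* The third point [(x3, - y3)] of the chord satisfies w = m z + 1 / ka. *)
have -> : y3^-1 = m * (x3 / (x * y3)) - ka^-1.
  apply: (mulfI ka0); rewrite mulrBr divff // mulrA -km.
  have eka : ka = - y3 - mu * x3 by rewrite y3E; ring.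
  by rewrite {1}eka; field; rewrite x0 y30.
apply: pintB => //; apply: pintM => //; rewrite zE.
apply: pintD => //; first exact: pintD.
by apply: pintM => //; apply: (pint_nat K 2 pr2 2).
Qed.

Let P : ec_point K := Some (x, 1).

Lemma near_multiple n : near_origin n%:R (iter n (ec_add E P) None).
Proof.
have int1 : int2 1 := pint_nat K 2 pr2 1.
have int0 : int2 0 := pint_nat K 2 pr2 0.
elim: n => [|n IH]; first by split; rewrite //= subrr mul0r.
rewrite iterS -natr1 addrC; apply: near_add => //; first exact: pint_nat.
split; rewrite /zcoord /wcoord /P.
- by rewrite on_curveE expr1n mulr1.
- exact: oner_neq0.
- by rewrite invr1.
- by rewrite mulr1 divff // subrr mul0r.
Qed.

Lemma multiple_eq_opp n i : iter n (ec_add E P) None = None -> (i <= n)%N ->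
  iter i (ec_add E P) None = ec_opp (iter (n - i) (ec_add E P) None).
Proof.
move=> n0; elim: i => [|i IH] lein; first by rewrite subn0 n0.
rewrite iterS IH 1?ltnW // -(subnSK lein) iterS.
have [on _ _ _] := near_multiple (n - i.+1).
apply: ec_add_cancel => //; first exact: oner_neq0.
by rewrite on_curveE expr1n mulr1.
Qed.

Lemma multiple_neq0 n : (0 < n)%N -> iter n (ec_add E P) None <> None.
Proof.
elim/ltn_ind: n => n IH n0 nP0.
have [n_odd|n_even] := boolP (odd n).
  have [_ _ _] := near_multiple n; rewrite nP0 /= sub0r => n_int.
  apply: (pint_invp K 2 pr2).
  have -> : 2^-1 = n%:R / 2 - n./2%:R :> K.
    have -> : n%:R = 1 + n./2%:R * 2 :> K.
      by rewrite -{1}(odd_double_half n) n_odd natrD -muln2 natrM.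
    by field.
  apply: pintB => //; last exact: pint_nat.
  by have := pintN K 2 pr2 _ n_int; rewrite mulNr opprK.
have en : n = n./2.*2 by rewrite -[LHS]odd_double_half (negPf n_even).
have m0 : (0 < n./2)%N by lia.
have mltn : (n./2 < n)%N by lia.
(* For m = n / 2 the relation reads mP = - mP, which forces a zero ordinate. *)
have := multiple_eq_opp n n./2 nP0 (ltnW mltn).
have -> : (n - n./2 = n./2)%N by lia.
have := IH _ mltn m0; have [_ ynz _ _] := near_multiple n./2.
case: (iter _ _ _) ynz => [[X Y]|] // Y0 _ [eY].
by move: Y0; rewrite -(mulrI_eq0 _ (mulfI two_neq0)) mulr_natl mulr2n {1}eY addNr eqxx.
Qed.

Lemma twist_rank_gt0 : (0 < mw_rank E)%E.
Proof.
apply: (@lt_le_trans _ _ 1%E); first by rewrite lte_fin ltr01.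
apply: ereal_sup_ubound; exists 1%N => //=; exists (fun=> P); split.
  by move=> _; rewrite on_curveE expr1n mulr1.
have add0 Q : ec_add E Q None = Q by case: Q => [[]|].
move=> c; rewrite big_ord_recl big_ord0 add0 => c0 i; rewrite [i]ord1.
case: (c ord0) c0 => [[|n]|n] // nP0; exfalso; apply: (multiple_neq0 n.+1 isT) => //.
by move: nP0; rewrite /ec_mulz; case: (iter _ _ _) => [[]|].
Qed.

End NonTorsion.

(** * The tangent process on [X^3 + Y^3 = 604 Z^3] *)

(** The third intersection of the tangent at (X : Y : Z) with X^3 + Y^3 = A Z^3, in a form free of
    A. *)
Definition tangent (P : int * int * int) : int * int * int :=
  let: (X, Y, Z) := P in
  (X * (X ^+ 3 + 2 * Y ^+ 3), - (Y * (2 * X ^+ 3 + Y ^+ 3)), Z * (X ^+ 3 - Y ^+ 3)).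

(** Here 604 = 9^3 - 5^3, and the starting point satisfies the congruences of [seq_mod], which the
    tangent process preserves. *)
Definition tangent_seq n := iter n tangent (- 5%:Z, 9%:Z, 1).
Definition seqX n := (tangent_seq n).1.1.
Definition seqY n := (tangent_seq n).1.2.
Definition seqZ n := (tangent_seq n).2.
Definition seqW n := seqX n ^+ 3 - seqY n ^+ 3.

Lemma seqXS n : seqX n.+1 = seqX n * (seqX n ^+ 3 + 2 * seqY n ^+ 3).
Proof. by rewrite /seqX /seqY /tangent_seq iterS; case: (iter _ _ _) => [[]]. Qed.

Lemma seqYS n : seqY n.+1 = - (seqY n * (2 * seqX n ^+ 3 + seqY n ^+ 3)).
Proof. by rewrite /seqX /seqY /tangent_seq iterS; case: (iter _ _ _) => [[]]. Qed.

Lemma seqZS n : seqZ n.+1 = seqZ n * seqW n.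
Proof.
by rewrite /seqW /seqZ /seqX /seqY /tangent_seq iterS; case: (iter _ _ _) => [[]].
Qed.

Lemma seq_curve n : seqX n ^+ 3 + seqY n ^+ 3 = 604 * seqZ n ^+ 3.
Proof.
elim: n => [//|n IH]; rewrite seqXS seqYS seqZS.
transitivity (604 * seqZ n ^+ 3 * seqW n ^+ 3); last by ring.
by rewrite -IH /seqW; ring.
Qed.

Lemma Euclid_dvdzX p (z : int) k : prime p -> (p %| z ^+ k)%Z -> (p %| z)%Z.
Proof. by move=> pp; rewrite !dvdzE abszX Euclid_dvdX // => /andP[]. Qed.

Lemma Euclid_dvdzM p (y z : int) : prime p -> (p %| y * z)%Z = (p %| y)%Z || (p %| z)%Z.
Proof. by move=> pp; rewrite !dvdzE abszM Euclid_dvdM. Qed.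

(* The condition at 3 keeps X and Y coprime: 3 is the only possible common factor of
   X^3 + 2 Y^3 and 2 X^3 + Y^3. *)
Lemma seq_mod n :
  [/\ ~~ (2 %| seqX n)%Z, (4 %| seqX n + seqY n)%Z, (5 %| seqX n)%Z, (5 %| seqY n + 1)%Z
    & (3 %| seqY n)%Z].
Proof.
elim: n => [//|n]; rewrite seqXS seqYS; move: (seqX n) (seqY n) => X Y.
case=> X2 XY4 X5 Y5 Y3; split.
- apply: contra X2 => X2; apply: (Euclid_dvdzX 2 X 4) => //.
  have -> : X ^+ 4 = X * (X ^+ 3 + 2 * Y ^+ 3) - 2 * (X * Y ^+ 3) by ring.
  by rewrite rpredB // dvdz_mulr.
- have -> : X * (X ^+ 3 + 2 * Y ^+ 3) - Y * (2 * X ^+ 3 + Y ^+ 3) = (X + Y) * (X - Y) ^+ 3.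
    by ring.
  by rewrite dvdz_mulr.
- by rewrite dvdz_mulr.
- have -> : - (Y * (2 * X ^+ 3 + Y ^+ 3)) + 1 =
      - (2 * X ^+ 2 * Y) * X - (Y - 1) * (Y ^+ 2 + 1) * (Y + 1) by ring.
  by rewrite rpredB // dvdz_mull.
- by rewrite rpredN dvdz_mulr.
Qed.

Lemma seq_coprime n p : prime p -> (p %| seqX n)%Z -> (p %| seqY n)%Z -> False.
Proof.
move=> pp; elim: n => [|n IH].
  rewrite !dvdzE => p5 p9; have: (p %| gcdn 5 9)%N by rewrite dvdn_gcd p5 p9.
  by rewrite dvdn1 => /eqP p1; rewrite p1 in pp.
have [_ _ _ _ ] := seq_mod n; rewrite seqXS seqYS rpredN !Euclid_dvdzM //.
move: (seqX n) (seqY n) IH => X Y nXY Y3.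
have XY k : (p %| X)%Z -> (p %| Y ^+ k)%Z -> False.
  by move=> pX /(Euclid_dvdzX p Y k pp); apply: nXY.
have YX k : (p %| X ^+ k)%Z -> (p %| Y)%Z -> False.
  by move=> /(Euclid_dvdzX p X k pp); apply: nXY.
case/orP=> [pX|pX3]; case/orP=> [pY|pY3].
- exact: nXY.
- apply: (XY 3%N) => //.
  have -> : Y ^+ 3 = 2 * X ^+ 3 + Y ^+ 3 - 2 * X ^+ 2 * X by ring.
  by rewrite rpredB // dvdz_mull.
- apply: (YX 3%N) => //.
  have -> : X ^+ 3 = X ^+ 3 + 2 * Y ^+ 3 - 2 * Y ^+ 2 * Y by ring.
  by rewrite rpredB // dvdz_mull.
have : (p %| 3 * X ^+ 3)%Z.
  have -> : 3 * X ^+ 3 = 2 * (2 * X ^+ 3 + Y ^+ 3) - (X ^+ 3 + 2 * Y ^+ 3) by ring.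
  by rewrite rpredB // dvdz_mull.
(* For p = 3, the invariant 3 | Y makes 3 divide X as well. *)
rewrite Euclid_dvdzM // => /orP[p3|/(Euclid_dvdzX p X 3 pp) pX].
  have ep : p = 3%N by apply/eqP; rewrite -dvdn_prime2 //.
  apply: (YX 3%N); last by rewrite ep.
  have -> : X ^+ 3 = X ^+ 3 + 2 * Y ^+ 3 - 2 * Y ^+ 2 * Y by ring.
  by rewrite rpredB // dvdz_mull // ep.
apply: (XY 3%N) => //.
have -> : Y ^+ 3 = 2 * X ^+ 3 + Y ^+ 3 - 2 * X ^+ 2 * X by ring.
by rewrite rpredB // dvdz_mull.
Qed.

Lemma seqX_odd n : ~~ (2 %| seqX n)%Z.
Proof. by case: (seq_mod n). Qed.

Lemma seqY_odd n : ~~ (2 %| seqY n)%Z.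
Proof.
have [X2 XY4 _ _ _] := seq_mod n; apply: contra X2 => Y2.
have -> : seqX n = seqX n + seqY n - seqY n by ring.
by rewrite rpredB // (dvdz_trans _ XY4).
Qed.

Lemma seqX_neq0 n : seqX n != 0.
Proof. by apply: contraNneq (seqX_odd n) => ->. Qed.

Lemma seqXZ_coprime n p : prime p -> (p %| seqZ n)%Z -> ~~ (p %| seqX n)%Z.
Proof.
move=> pp pZ; apply/negP => pX; apply: (seq_coprime n p pp pX).
apply: (Euclid_dvdzX p _ 3) => //.
have -> : seqY n ^+ 3 = seqX n ^+ 3 + seqY n ^+ 3 - seqX n ^+ 2 * seqX n by ring.
by rewrite seq_curve rpredB ?dvdz_mull // exprS dvdz_mulr.
Qed.

(** Modulo 4, Y = - X, hence W = 2 X^3 with X odd. *)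
Lemma seqW_half n : exists2 V : int, seqW n = 2 * V & ~~ (2 %| V)%Z.
Proof.
rewrite /seqW; have [X2 /dvdzP[t XY4] _ _ _] := seq_mod n.
have -> : seqY n = 4 * t - seqX n by rewrite mulrC -XY4; ring.
move: (seqX n) X2 => X X2.
exists (X ^+ 3 - 2 * (16 * t ^+ 3 - 12 * t ^+ 2 * X + 3 * t * X ^+ 2)); first by ring.
apply: contra X2 => V2; apply: (Euclid_dvdzX 2 X 3) => //.
by move: V2; rewrite rpredBr // dvdz_mulr.
Qed.

Lemma seqW_mod5 n : (5 %| seqW n - 1)%Z.
Proof.
have [_ _ X5 Y5 _] := seq_mod n; rewrite /seqW; move: (seqX n) (seqY n) X5 Y5 => X Y X5 Y5.
have -> : X ^+ 3 - Y ^+ 3 - 1 = X ^+ 2 * X - (Y ^+ 2 - Y + 1) * (Y + 1) by ring.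
by rewrite rpredB // dvdz_mull.
Qed.

Lemma seqW_neq0 n : seqW n != 0.
Proof. by apply: contraTneq (seqW_mod5 n) => ->. Qed.

Lemma seqZ_neq0 n : seqZ n != 0.
Proof. by elim: n => [//|n IH]; rewrite seqZS mulf_neq0 // seqW_neq0. Qed.

Lemma seqZ_pow2 n : (2%:Z ^+ n %| seqZ n)%Z.
Proof.
elim: n => [//|n IH]; rewrite seqZS exprSr dvdz_mul //.
by have [V -> _] := seqW_half n; rewrite dvdz_mulr.
Qed.

(** * Primes of odd valuation in Z_n *)

Lemma sqrn_of_even_logn n : (0 < n)%N ->
  (forall p, prime p -> ~~ odd (logn p n)) -> exists s, n = (s * s)%N.
Proof.
move=> n0 even_log; exists (\prod_(p <- primes n) p ^ (logn p n)./2)%N.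
rewrite [LHS]prod_prime_decomp // prime_decompE big_map -big_split.
apply: eq_big_seq => p; rewrite mem_primes => /andP[pp _] /=.
by rewrite -expnD addnn -[in LHS](odd_double_half (logn p n)) (negPf (even_log p pp)).
Qed.

Lemma seqW_odd_prime n : exists p, [/\ prime p, p != 2%N & odd (logn p `|seqW n|)].
Proof.
have [V eW V2] := seqW_half n.
have V0 : (0 < `|V|)%N.
  by rewrite absz_gt0; apply: contraNneq V2 => ->.
suff [p [pp p_odd]] : exists p, prime p /\ odd (logn p `|V|).
  have p2 : p != 2%N.
    apply: contraTneq p_odd => ->; rewrite lognE V0 /=.
    by rewrite dvdzE in V2; rewrite (negPf V2).
  exists p; split=> //; rewrite eW abszM lognM //.
  by rewrite (_ : logn p _ = 0%N) // logn_prime // (negPf p2).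
apply: contrapT => no_p.
have [|s es] := sqrn_of_even_logn _ V0.
  by move=> p pp; apply/negP => p_odd; apply: no_p; exists p.
(* Squaring removes the sign of [seqW n]; modulo 5 the left side is 1 and the right side is 0 or
   4. *)
have W2 : (`|seqW n| ^ 2 = 4 * s ^ 4)%N.
  by rewrite eW abszM es /=; ring.
have : (5 %| (`|seqW n| ^ 2)%N%:Z - 1)%Z.
  have -> : (`|seqW n| ^ 2)%N%:Z - 1 = (seqW n + 1) * (seqW n - 1).
    by rewrite -natz natrX natz abszE real_normK ?num_real //; ring.
  by rewrite dvdz_mull // seqW_mod5.
rewrite -eqz_mod_dvd W2 -[1]/(1%:Z) !modz_nat eqz_nat -modnMmr -modnXm.
by have := ltn_pmod s (isT : (0 < 5)%N); case: (s %% 5)%N => [|[|[|[|[|]]]]].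
Qed.

(** [p] divides Z_n, hence X_n^3 + Y_n^3. If it also divided W_n, it would divide 2 X_n^3, although
    X_n is prime to Z_n. *)
Lemma seqW_disjoint p m n : prime p -> p != 2%N -> (m < n)%N ->
  (p %| seqW m)%Z -> ~~ (p %| seqW n)%Z.
Proof.
move=> pp p2 mn pm; apply/negP => pn.
have pZ : (p %| seqZ n)%Z.
  elim: n mn {pn} => // n IH; rewrite ltnS leq_eqVlt seqZS => /orP[/eqP <-|/IH pZ].
    by rewrite dvdz_mull.
  by rewrite dvdz_mulr.
move/negP: (seqXZ_coprime n p pp pZ); apply; apply: (Euclid_dvdzX p _ 3) => //.
have : (p %| 2 * seqX n ^+ 3)%Z.
  have -> : 2 * seqX n ^+ 3 = seqX n ^+ 3 + seqY n ^+ 3 + seqW n by rewrite /seqW; ring.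
  by rewrite seq_curve rpredD // exprS dvdz_mull // dvdz_mulr.
by rewrite Euclid_dvdzM // dvdzE /= dvdn_prime2 // (negPf p2).
Qed.

Lemma logn_seqZ p m n : prime p -> p != 2%N -> (p %| seqW m)%Z -> (m < n)%N ->
  logn p `|seqZ n| = logn p `|seqW m|.
Proof.
move=> pp p2 pm; have pW i : i != m -> logn p `|seqW i| = 0%N.
  move=> im; apply/eqP; rewrite lognE pp absz_gt0 seqW_neq0 /=.
  case: ifP => // pi; move: im; rewrite neq_ltn => /orP[im|mi].
    by have := seqW_disjoint p i m pp p2 im pi; rewrite pm.
  by have := seqW_disjoint p m i pp p2 mi pm; rewrite dvdzE pi.
have lognS i : logn p `|seqZ i.+1| = (logn p `|seqZ i| + logn p `|seqW i|)%N.
  by rewrite seqZS abszM lognM ?absz_gt0 ?seqZ_neq0 ?seqW_neq0.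
have low i : (i <= m)%N -> logn p `|seqZ i| = 0%N.
  elim: i => [|i IH] im; first by rewrite /seqZ /= logn1.
  by rewrite lognS (IH (ltnW im)) pW // neq_ltn im.
elim: n => // n IH; rewrite ltnS leq_eqVlt lognS => /orP[/eqP <-|mn].
  by rewrite low.
by rewrite IH // (pW n) ?addn0 // neq_ltn mn orbT.
Qed.

Lemma seqZ_odd_prime B n : (B.+2 <= n)%N ->
  exists p, [/\ prime p, (B < p)%N, p != 2%N & odd (logn p `|seqZ n|)].
Proof.
have [p pP] := choice seqW_odd_prime => Bn.
have p_dvd m : (p m %| seqW m)%Z.
  have [pp _] := pP m; rewrite dvdzE lognE pp absz_gt0 seqW_neq0 /=.
  by case: (_ %| _)%N.
suff [m mB Bpm] : exists2 m, (m < B.+2)%N & (B < p m)%N.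
  have [pp p2 p_odd] := pP m; exists (p m); split=> //.
  by rewrite (logn_seqZ _ m) // (leq_trans mB).
apply: contrapT => p_small.
have p_le (i : 'I_B.+2) : (p i < B.+1)%N.
  by rewrite ltnS leqNgt; apply/negP => Bp; apply: p_small; exists i.
(* Pigeonhole: distinct indices give distinct primes, so B + 2 of them cannot all be at most B. *)
have inj : injective (fun i => Ordinal (p_le i)).
  have neq i j : (i < j)%N -> p i <> p j.
    move=> ij epij; have [pp p2 _] := pP i; have := p_dvd j.
    by rewrite -epij (negPf (seqW_disjoint _ _ _ pp p2 ij (p_dvd i))).
  move=> i j [epij]; apply: val_inj.
  by case: (ltngtP i j) => // /neq; rewrite epij.
by have := leq_card _ inj; rewrite !card_ord ltnn.
Qed.

(** * Square classes *)

(** Each term is at least its predecessor and the threshold of its predecessor, hence exceeds or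
    meets the thresholds of all earlier terms. *)
Lemma exists_subsequence (R : nat -> nat -> Prop) n0 :
  (forall m, (n0 <= m)%N -> exists N, forall n, (N <= n)%N -> R m n) ->
  exists s : nat -> nat, (forall k, (n0 <= s k)%N) /\ (forall i j, (i < j)%N -> R (s i) (s j)).
Proof.
move=> ev; have [m|N NP] := choice (_ : forall m, exists N,
    (n0 <= m)%N -> forall n, (N <= n)%N -> R m n).
  by case: (leqP n0 m) => [/ev[N NP]|_]; [exists N|exists 0%N].
pose s k := iter k (fun m => maxn (N m) m) n0.
have s_ge k : (n0 <= s k)%N by elim: k => //= k IH; rewrite leq_max IH orbT.
exists s; split=> // i j ij; apply: NP => //.
by elim: j ij => //= j IH; rewrite ltnS leq_eqVlt leq_max => /orP[/eqP ->|/IH ->];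
  rewrite ?leqnn ?orbT.
Qed.

Lemma infinite_range (T : Type) (f : nat -> T) :
  injective f -> infinite_set [set f k | k in setT].
Proof.
move=> f_inj fin; apply: infinite_nat.
rewrite (_ : [set: nat] = f @^-1` [set f k | k in setT]).
  by apply: finite_preimage => // x y _ _ /f_inj.
by apply/seteqP; split=> // k _; exists k.
Qed.

Section Twists.
Variable K : fieldExtType rat.

Lemma intK_eq0 (z : int) : ((z%:~R : K) == 0) = (z == 0).
Proof. by case: z => n; rewrite ?NegzE ?rmorphN /= ?oppr_eq0 -pmulrn natK_eq0. Qed.

Lemma eventually_small (a : K) : exists n0, forall n, (n0 <= n)%N -> forall u : int,
  ~~ (2 %| u)%Z -> pint K 2 (a / (u%:~R / (seqZ n)%:~R) ^+ 3 / 2).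
Proof.
have pr2 : prime 2 by [].
(* 2^k clears the denominator of [a] at 2; one more factor 2 of Z_n pays for the final division by
   2. *)
have [k ka] := pint_clear K 2 pr2 a; exists k.+1 => n kn u u2.
have u0 : u%:~R != 0 :> K by rewrite intK_eq0; apply: contraNneq u2 => ->.
have Z0 : (seqZ n)%:~R != 0 :> K by rewrite intK_eq0 seqZ_neq0.
have two_neq0 := natp_neq0 K 2 pr2.
have /dvdzP[q eZ] := seqZ_pow2 n.
have -> : a / (u%:~R / (seqZ n)%:~R) ^+ 3 / 2 =
    2 ^+ k * a * (2 ^+ (n - k.+1) * q * seqZ n ^+ 2)%:~R * u%:~R^-1 ^+ 3.
  have eZK : (seqZ n)%:~R = q%:~R * (2 ^+ k * 2 * 2 ^+ (n - k.+1)) :> K.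
    by rewrite eZ -exprSr -exprD subnKC // rmorphM rmorphXn.
  rewrite !rmorphM !rmorphXn /= -[2%:~R]/(2 : K).
  move: Z0 eZK; move: (2 ^+ (n - k.+1)) (2 ^+ k) ((seqZ n)%:~R : K) => s t Z Z0 eZK.
  transitivity (a * Z ^+ 2 * Z / (u%:~R ^+ 3) / 2); first by field; rewrite u0 two_neq0 Z0.
  by rewrite {2}eZK; field; rewrite u0 two_neq0.
apply: pintM => //; first by apply: pintM => //; apply: pint_int.
by apply: pintX => //; apply: pint_invz.
Qed.

Definition twist_param (a : K) n := ((seqX n)%:~R / (seqZ n)%:~R) ^+ 3 + a.

Lemma eventually_new_class (a d : K) : d != 0 ->
  exists N, forall n, (N <= n)%N -> ~ same_square_class d (twist_param a n).
Proof.
move=> d0; have [B0 not_sqr] := pint_not_sqr K.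
have [B1 a_int] := pint_large K a; have [B2 d_int] := pint_large K d.
have [B3 dV_int] := pint_large K d^-1.
exists (maxn (maxn B0 B1) (maxn B2 B3)).+2 => n Bn [c c0 ed].
have [p [pp]] := seqZ_odd_prime _ _ Bn.
rewrite !gtn_max => /andP[/andP[Bp0 Bp1] /andP[Bp2 Bp3]] _ v_odd.
have {}a_int := a_int p pp Bp1; have {}d_int := d_int p pp Bp2.
have {}dV_int := dV_int p pp Bp3.
have Z0 := seqZ_neq0 n.
have Zgt0 : (0 < `|seqZ n|)%N by rewrite absz_gt0.
have [v0 eZ] : exists v0, logn p `|seqZ n| = v0.+1.
  by case: (logn _ _) v_odd => // v _; exists v.
have [z pz ez] : exists2 z : int, ~~ (p %| z)%Z & seqZ n = p%:Z ^+ v0.+1 * z.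
  have [m pm em] := pfactor_coprime pp Zgt0; exists ((-1) ^+ (seqZ n < 0)%R * m%:Z).
    by rewrite dvdzE abszMsign /= -prime_coprime.
  by rewrite [LHS]intEsign em eZ PoszM -!natz natrX; ring.
have pX : ~~ (p %| seqX n)%Z.
  apply: seqXZ_coprime => //; rewrite ez exprS -mulrA; exact: dvdz_mulr.
have p0 := natp_neq0 K p pp.
have X0 : (seqX n)%:~R != 0 :> K by rewrite intK_eq0 seqX_neq0.
have z0 : z%:~R != 0 :> K by rewrite intK_eq0; apply: contraNneq pz => ->.
have XV_int := pint_invz K p pp _ pX; have zV_int := pint_invz K p pp _ pz.
have X_int := pint_int K p pp (seqX n); have z_int := pint_int K p pp z.
have pM := pintM K p pp.
(* [p * g] is a Z_n^3 / X_n^3, so D_n = X_n^3 (1 + p g) / Z_n^3 is a unit at [p] up to an odd power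
   of [p]. *)
pose g : K := p%:R ^+ (v0 * 3 + 2) * a * z%:~R ^+ 3 * (seqX n)%:~R^-1 ^+ 3.
have g_int : pint K p g.
  apply: (pM); last exact: pintX.
  apply: (pM); last exact: pintX.
  by apply: (pM) => //; apply: pintX => //; apply: pint_nat.
have [h0 h_int] := pint_1pM_unit K p pp g g_int.
pose u : K := (seqX n)%:~R ^+ 3 * (1 + p%:R * g) * z%:~R^-1 ^+ 3 * d^-1.
apply: (not_sqr p pp Bp0 (v0.+1 * 3)%N c^-1 u).
- by rewrite oddM -eZ v_odd.
- by rewrite /u !mulf_neq0 // ?expf_neq0 ?invr_neq0.
- apply: (pM) => //; apply: (pM); last exact: pintX.
  apply: (pM); first exact: pintX.
  by apply: pintD => //; [exact: (pint_nat K p pp 1)|apply: (pM) => //; exact: pint_nat].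
- have -> : u^-1 = (seqX n)%:~R^-1 ^+ 3 * (1 + p%:R * g)^-1 * z%:~R ^+ 3 * d.
    by rewrite /u; move: (1 + _) h0 => h h0; field; rewrite X0 z0 d0 h0.
  apply: (pM) => //; apply: (pM); last exact: pintX.
  by apply: (pM) => //; exact: pintX.
have ez' : (seqZ n)%:~R = p%:R ^+ v0.+1 * z%:~R :> K by rewrite ez rmorphM rmorphXn.
have d'0 : twist_param a n != 0 by apply: contraNneq d0; rewrite ed => ->; rewrite mul0r.
have pv0 : p%:R ^+ v0 != 0 :> K by rewrite expf_neq0.
have eD : twist_param a n =
    (seqX n)%:~R ^+ 3 * (1 + p%:R * g) / (p%:R ^+ (v0.+1 * 3) * z%:~R ^+ 3).
  rewrite /twist_param /g ez' exprD !exprM [p%:R ^+ v0.+1]exprS.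
  by move: (p%:R ^+ v0 : K) pv0 => q q0; field; rewrite X0 z0 p0 q0.
rewrite /u ed; move: eD; move: (twist_param a n) d'0 => t t0 eD.
have -> : (seqX n)%:~R ^+ 3 * (1 + p%:R * g) = t * (p%:R ^+ (v0.+1 * 3) * z%:~R ^+ 3).
  by rewrite eD divfK // mulf_neq0 // expf_neq0.
by field; rewrite c0 t0 z0.
Qed.

Lemma same_square_class_sym (d d' : K) : same_square_class d d' -> same_square_class d' d.
Proof.
case=> c c0 ->; exists c^-1; first by rewrite invr_eq0.
by field.
Qed.

(** The numerator [u] of the second abscissa is left free: it is X_n when the curves coincide and
    -Y_n otherwise. *)
Lemma twists_of_common_param (b1 b2 lambda : K) (u : nat -> int) :
  (forall n, ~~ (2 %| u n)%Z) ->
  (forall n, twist_param (lambda * b1) n = ((u n)%:~R / (seqZ n)%:~R) ^+ 3 + lambda * b2) ->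
  exists S : set K,
    [/\ infinite_set S,
        (forall D : K, S D -> D != 0),
        (forall D D' : K, S D -> S D' -> D <> D' -> ~ same_square_class D D')
      & (forall D : K, S D ->
           (0 < mw_rank (quad_twist D (j0_curve (lambda * b1))))%E /\
           (0 < mw_rank (quad_twist D (j0_curve (lambda * b2))))%E)].
Proof.
move=> u_odd eD; have [n1 small1] := eventually_small (lambda * b1).
have [n2 small2] := eventually_small (lambda * b2).
pose d := twist_param (lambda * b1).
have frac_neq0 (v : int) n : ~~ (2 %| v)%Z -> v%:~R / (seqZ n)%:~R != 0 :> K.
  move=> v2; rewrite mulf_neq0 // ?invr_eq0 intK_eq0 ?seqZ_neq0 //.
  by apply: contraNneq v2 => ->.
have d_neq0 n : (maxn n1 n2 <= n)%N -> d n != 0.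
  rewrite geq_max => /andP[n1n _]; have X2 := seqX_odd n.
  exact: twist_coef_neq0 (frac_neq0 _ _ X2) (small1 _ n1n _ X2).
have [|s [s_ge s_class]] := exists_subsequence
  (fun m n => ~ same_square_class (d m) (d n)) (maxn n1 n2).
  by move=> m /d_neq0; apply: eventually_new_class.
have ds_inj : injective (d \o s).
  have neq i j : (i < j)%N -> d (s i) <> d (s j).
    move=> ij e; apply: (s_class i j ij); exists 1; first exact: oner_neq0.
    by rewrite e expr1n mulr1.
  move=> i j /= e; case: (ltngtP i j) => // /neq; [by []|by move/(_ (esym e))].
exists [set d (s k) | k in setT]%classic; split.
- exact: (infinite_range _ (d \o s)).
- by move=> _ [k _ <-]; apply: d_neq0.
- move=> _ _ [i _ <-] [j _ <-] dij; case: (ltngtP i j) => [ij|ji|eij].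
  + exact: s_class.
  + by move=> /same_square_class_sym; apply: s_class.
  + by case: dij; rewrite eij.
move=> _ [k _ <-]; have := s_ge k; rewrite geq_max => /andP[kn1 kn2].
split.
  have X2 := seqX_odd (s k).
  exact: twist_rank_gt0 (frac_neq0 _ _ X2) (small1 _ kn1 _ X2).
rewrite /d eD.
exact: twist_rank_gt0 (frac_neq0 _ _ (u_odd _)) (small2 _ kn2 _ (u_odd _)).
Qed.

End Twists.

Theorem theorem1p5 (K : fieldExtType rat) (b1 b2 : K)
    (hb1 : b1 != 0) (hb2 : b2 != 0) :
  exists lambda : K, lambda != 0 /\
    exists S : set K,
      [/\ infinite_set S,
          (forall D : K, S D -> D != 0),
          (forall D D' : K, S D -> S D' -> D <> D' -> ~ same_square_class D D')
        & (forall D : K, S D ->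
             (0 < mw_rank (quad_twist D (j0_curve (lambda * b1))))%E /\
             (0 < mw_rank (quad_twist D (j0_curve (lambda * b2))))%E)].
Proof.
have [e12|b12] := eqVneq b1 b2.
  exists 1; split; first exact: oner_neq0.
  apply: (twists_of_common_param _ _ _ _ seqX) => [n|n]; first exact: seqX_odd.
  by rewrite e12.
have c0 : 604%:~R != 0 :> K by rewrite intK_eq0.
have db0 : b2 - b1 != 0 by rewrite subr_eq0 eq_sym.
(* This makes lambda (b2 - b1) = 604 = (X_n / Z_n)^3 + (Y_n / Z_n)^3, so the abscissas X_n / Z_n and
   -Y_n / Z_n give the same D. *)
exists (604%:~R / (b2 - b1)); split; first by rewrite mulf_neq0 ?invr_neq0.
apply: (twists_of_common_param _ _ _ _ (fun n => - seqY n)) => n.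
  by rewrite rpredN seqY_odd.
have Z0 : (seqZ n)%:~R != 0 :> K by rewrite intK_eq0 seqZ_neq0.
have curve : (seqX n)%:~R ^+ 3 + (seqY n)%:~R ^+ 3 = 604%:~R * (seqZ n)%:~R ^+ 3 :> K.
  by rewrite -!rmorphXn -rmorphD -rmorphM seq_curve.
move: c0 curve; rewrite /twist_param rmorphN; move: (604%:~R : K) => c c0 curve.
have eX : (seqX n)%:~R ^+ 3 = c * (seqZ n)%:~R ^+ 3 - (seqY n)%:~R ^+ 3 :> K.
  by rewrite -curve addrK.
rewrite !expr_div_n eX; by field; rewrite Z0 db0.
Qed.
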